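(* Given $\beta>0$ and $\alpha\in\mathbb{R}\setminus\mathbb{Q}$, the sequence $\left(k^{\beta}\cdot\sin(2\pi k\alpha)\right)_{k\in\mathbb{N}}$ is dense in $\mathbb{R}$ if and only if at least one of the following holds: 1. $\mu_+(\alpha,\beta)=0$ and $\mu_-(\alpha,\beta)=0$; 2. $\mu_+(\alpha,\beta)=0$ and $\mu_+\left(\alpha,\beta,\frac12\right)=0$; 3. $\mu_-(\alpha,\beta)=0$ and $\mu_-\left(\alpha,\beta,\frac12\right)=0$.
   Context: For $x\in\mathbb{R}$, $\{x\}_2$ is the signed fractional part, the unique number in $[-\frac12,\frac12)$ with $x-\{x\}_2\in\mathbb{Z}$. For $\alpha\in\mathbb{R}\setminus\mathbb{Q}$, $\beta>0$, $\rho\in\mathbb{R}$ set $$\mu_+(\alpha,\beta,\rho)=\liminf_{k\to+\infty,\ \{k\alpha-\rho\}_2>0}k^\beta\{k\alpha-\rho\}_2,\qquad \mu_-(\alpha,\beta,\rho)=\liminf_{k\to+\infty,\ \{k\alpha-\rho\}_2<0}-k^\beta\{k\alpha-\rho\}_2 ,$$ where $k$ ranges over $\mathbb{N}=\{1,2,\dots\}$, and $\mu_\pm(\alpha,\beta)=\mu_\pm(\alpha,\beta,0)$. *)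

(* Defs.v *)
From mathcomp Require Export all_boot all_order all_algebra.
From mathcomp Require Export all_classical all_reals all_analysis.
From mathcomp Require Import lra.

Set Implicit Arguments.
Unset Strict Implicit.
Unset Printing Implicit Defensive.

Import Order.TTheory GRing.Theory Num.Theory.
Import numFieldNormedType.Exports.

Local Open Scope classical_set_scope.
Local Open Scope ring_scope.

Definition signed_frac (R : realType) (x : R) : R :=
  x - (Num.floor (x + 2^-1))%:~R.

Lemma signed_fracP (R : realType) (x y : R) :
  y = signed_frac x <->
  [/\ - 2^-1 <= y, y < 2^-1 & exists n : int, x - y = n%:~R].
Proof.
split=> [->|[ylo yhi [n xy]]].
- have lo := floor_le (x + 2^-1).
  have hi := floorD1_gt (x + 2^-1); rewrite intrD in hi.
  rewrite /signed_frac; split; [lra | lra |].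
  by exists (Num.floor (x + 2^-1)); rewrite opprB addrC subrK.
- rewrite /signed_frac (floor_def (m := n)); first lra.
  by rewrite intrD; apply/andP; split; lra.
Qed.

(* The lower limits are taken along the filter of neighborhoods of +oo in nat
   restricted to the indices satisfying the sign condition, and take values in
   \bar R (+oo if only finitely many indices satisfy it).  The index k = 0 is
   irrelevant for that filter. *)
Definition mu_plus (R : realType) (alpha beta rho : R) : \bar R :=
  limf_einf
    (fun k : nat => (k%:R `^ beta * signed_frac (k%:R * alpha - rho))%:E)
    (within [set k : nat | 0 < signed_frac (k%:R * alpha - rho)] \oo).

Definition mu_minus (R : realType) (alpha beta rho : R) : \bar R :=
  limf_einf
    (fun k : nat => (- (k%:R `^ beta * signed_frac (k%:R * alpha - rho)))%:E)
    (within [set k : nat | signed_frac (k%:R * alpha - rho) < 0] \oo).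

(* Main.v *)
(* Since sin (2 pi x) is close to 2 pi x near 0 and to - 2 pi (x - 1/2) near
   1/2, small positive values of k^beta sin (2 pi k alpha) come either from
   mu_+(alpha, beta) = 0 or from mu_-(alpha, beta, 1/2) = 0, and small negative
   ones from mu_-(alpha, beta) = 0 or mu_+(alpha, beta, 1/2) = 0; doubling k
   shows that mu_+-(alpha, beta, 1/2) = 0 implies mu_+-(alpha, beta) = 0, which
   leaves the three listed cases.  Conversely, if k alpha = rho + n + d with
   2 rho an integer and k^beta d tiny, then for odd m the multiple m k is at
   signed distance m d from rho modulo 1, and (m k)^beta m d =
   m^(beta + 1) (k^beta d).  As m runs over the odd integers these values have
   successive ratios tending to 1, so they approximate any prescribed positive
   number; m d stays small because k^beta is large. *)

Require Import Defs.
From mathcomp Require Import ring lra.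

Set Implicit Arguments.
Unset Strict Implicit.
Unset Printing Implicit Defensive.

Import Order.TTheory GRing.Theory Num.Theory.
Import numFieldNormedType.Exports.

Local Open Scope classical_set_scope.
Local Open Scope ring_scope.

(** * Vanishing lower limits as statements about small values *)

(** Since [f] is nonnegative on [D], the lower limit is at least 0, and it is 0 exactly when no tail
    has a positive lower bound. For finite [D] both sides fail. *)
Lemma limf_einf_within_eq0 (R : realType) (D : set nat) (f : nat -> R) :
  (forall k, D k -> 0 <= f k) ->
  limf_einf (fun k => (f k)%:E) (within D \oo) = 0%E <->
  forall (e : R) (N : nat), 0 < e -> exists k, [/\ (N <= k)%N, D k & f k < e].
Proof.
move=> f_ge0; rewrite limf_einfE; split=> [f0 e N e_gt0|small].
  apply: contrapT => /forallNP noK.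
  have : (e%:E <= 0 :> \bar R)%E.
    rewrite -f0; apply: le_trans (ereal_sup_ubound _); last first.
      exists [set k | (N <= k)%N /\ D k] => //.
      by exists N => // k /= Nk Dk.
    apply/ereal_infP => _ [k [Nk Dk] <-]; rewrite lee_fin leNgt.
    by apply/negP => fke; apply: (noK k).
  by rewrite lee_fin leNgt e_gt0.
apply/eqP; rewrite eq_le; apply/andP; split.
  apply/ereal_supP => _ [V [N _ NV] <-].
  apply/lee_addgt0Pr => e e_gt0; rewrite add0e.
  have [k [Nk Dk fke]] := small e N e_gt0.
  apply: le_trans (_ : (f k)%:E <= _)%E; last by rewrite lee_fin ltW.
  by apply: ereal_inf_lbound; exists k => //; apply: NV.
apply: le_trans (ereal_sup_ubound _); last first.
  by exists D => //; exists 0%N.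
by apply/ereal_infP => _ [k Dk <-]; rewrite lee_fin f_ge0.
Qed.

Lemma powR_ge1 (R : realType) (x p : R) : 1 <= x -> 0 <= p -> 1 <= x `^ p.
Proof. by move=> x1 p0; rewrite -(powRr0 x) ler_powR. Qed.

(* [approx alpha beta e c] says that [mu_plus] (for [e = false]) or [mu_minus]
   (for [e = true]) vanishes at [rho = c%:R / 2]. *)
Definition approx (R : realType) (alpha beta : R) (e c : bool) :=
  forall (eps : R) (N : nat), 0 < eps ->
  exists k (n : int) (d : R),
    [/\ (N <= k)%N, 0 < d, k%:R `^ beta * d < eps
      & k%:R * alpha = c%:R / 2 + n%:~R + (-1) ^+ e * d].

Lemma mu_plus_eq0 (R : realType) (alpha beta : R) (c : bool) :
  0 < beta ->
  mu_plus alpha beta (c%:R / 2) = 0%E <-> approx alpha beta false c.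
Proof.
move=> beta_gt0; rewrite /mu_plus limf_einf_within_eq0; last first.
  by move=> k sf_gt0; rewrite mulr_ge0 ?powR_ge0 ?ltW.
split=> [small eps N eps_gt0|small eps N eps_gt0].
  have [k [Nk /= sf_gt0 sf_lt]] := small eps N eps_gt0.
  have [_ _ [n En]] := (signed_fracP (k%:R * alpha - c%:R / 2) _).1 erefl.
  exists k, n, (signed_frac (k%:R * alpha - c%:R / 2)); split=> //.
  by rewrite expr0 -En; lra.
(* As [k >= 1], the factor [k%:R ^ beta] is at least 1, so the cap [4^-1] bounds [d] itself and
   makes it the signed fractional part. *)
have min_gt0 : 0 < Num.min eps 4^-1 by rewrite lt_min eps_gt0 /=; lra.
have [k [n [d [Nk d_gt0]]]] := small _ N.+1 min_gt0.
rewrite lt_min expr0 mul1r => /andP[d_lt d_lt4] Ek.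
have k1 : 1 <= k%:R `^ beta.
  by apply: powR_ge1 (ltW beta_gt0); rewrite ler1n (leq_trans _ Nk).
have d4 : d < 4^-1 by apply: le_lt_trans d_lt4; rewrite ler_peMl// ltW.
have sfd : d = signed_frac (k%:R * alpha - c%:R / 2).
  by apply/signed_fracP; split; [lra | lra | exists n; lra].
by exists k; rewrite /= -sfd; split=> //; exact: ltnW.
Qed.

Lemma mu_minus_eq0 (R : realType) (alpha beta : R) (c : bool) :
  0 < beta ->
  mu_minus alpha beta (c%:R / 2) = 0%E <-> approx alpha beta true c.
Proof.
move=> beta_gt0; rewrite /mu_minus limf_einf_within_eq0; last first.
  by move=> k sf_lt0; rewrite -mulrN mulr_ge0 ?powR_ge0 ?oppr_ge0 ?ltW.
split=> [small eps N eps_gt0|small eps N eps_gt0].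
  have [k [Nk /= sf_lt0 sf_lt]] := small eps N eps_gt0.
  have [_ _ [n En]] := (signed_fracP (k%:R * alpha - c%:R / 2) _).1 erefl.
  exists k, n, (- signed_frac (k%:R * alpha - c%:R / 2)).
  by rewrite oppr_gt0 mulrN; split=> //; rewrite expr1 -En; lra.
have min_gt0 : 0 < Num.min eps 4^-1 by rewrite lt_min eps_gt0 /=; lra.
have [k [n [d [Nk d_gt0]]]] := small _ N.+1 min_gt0.
rewrite lt_min expr1 mulN1r => /andP[d_lt d_lt4] Ek.
have k1 : 1 <= k%:R `^ beta.
  by apply: powR_ge1 (ltW beta_gt0); rewrite ler1n (leq_trans _ Nk).
have d4 : d < 4^-1 by apply: le_lt_trans d_lt4; rewrite ler_peMl// ltW.
have sfd : - d = signed_frac (k%:R * alpha - c%:R / 2).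
  by apply/signed_fracP; split; [lra | lra | exists n; lra].
by exists k; rewrite /= -sfd oppr_lt0 mulrN opprK; split=> //; exact: ltnW.
Qed.

Lemma approx_double (R : realType) (alpha beta : R) (e : bool) :
  approx alpha beta e true -> approx alpha beta e false.
Proof.
move=> small eps N eps_gt0.
have p2 : 0 < 2 `^ beta :> R by rewrite powR_gt0.
(* Passing from [k], [d] to [2 * k], [2 * d] multiplies the product by [2 * 2 ^ beta]. *)
have [|k [n [d [Nk d_gt0 d_lt Ek]]]] := small (eps / (2 * 2 `^ beta)) N.
  by rewrite divr_gt0// mulr_gt0.
exists (2 * k)%N, (1 + 2 * n), (2 * d); split.
- by rewrite (leq_trans Nk)// leq_pmull.
- by rewrite mulr_gt0.
- move: d_lt; rewrite ltr_pdivlMr ?mulr_gt0// natrM powRM//.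
  by rewrite mulrC [X in _ -> X < _](_ : _ = 2 * 2 `^ beta * (k%:R `^ beta * d));
    last ring.
- by rewrite natrM -mulrA Ek rmorphD rmorphM /=; field.
Qed.

(** * Sine near its zeros *)

Lemma sin_half_turn (R : realType) (c : bool) (n : int) (x : R) :
  sin (2 * pi * (c%:R / 2 + n%:~R + x)) = (-1) ^+ c * sin (2 * pi * x).
Proof.
have per (y : R) (m : nat) : sin (y + 2 * pi * m%:R) = sin y.
  rewrite -(periodicn (@sinD2pi R) m y); congr (sin (y + _)).
  by rewrite -[RHS]mulr_natr -[pi *+ 2]mulr_natr; ring.
have perz (y : R) : sin (y + 2 * pi * n%:~R) = sin y.
  case: n => m; first exact: per.
  by rewrite NegzE mulrNz mulrN -(per (_ - _) m.+1) subrK.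
rewrite (_ : _ * _ = 2 * pi * x + pi * c%:R + 2 * pi * n%:~R); last by field.
rewrite perz; case: c; rewrite ?mulr1 ?mulr0 ?addr0 ?mul1r//.
by rewrite sinDpi expr1 mulN1r.
Qed.

(** By the mean value theorem [sin x = cos c * x] with [c] in [[0, x]], and the cosine decreases on
    [[0, pi]]. *)
Lemma sin_bounds (R : realType) (x : R) :
  0 <= x <= pi -> cos x * x <= sin x <= x.
Proof.
move=> /andP[x_ge0 x_lepi].
have [c] := @MVT_segment R sin cos 0 x x_ge0 (fun y _ => is_derive_sin y)
  (continuous_subspaceT (@continuous_sin R)).
rewrite in_itv /= => /andP[c_ge0 c_lex].
rewrite sin0 !subr0 => ->; rewrite ler_wpM2r//=; last first.
  case: ltgtP c_lex => // [cx _|->//].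
  by rewrite ltW// ltr_cos ?in_itv//=; apply/andP; split=> //; lra.
by rewrite -[leRHS]mul1r ler_wpM2r// cos_le1.
Qed.

(** With [y = pi * x <= pi / 4], [cos (2y) >= 0] gives [2 cos^2 y >= 1], so [sin (2y) = 2 sin y cos
    y >= 2 y cos^2 y >= y >= x]. *)
Lemma le_sin_2pi (R : realType) (x : R) :
  0 <= x <= 4^-1 -> x <= sin (2 * pi * x).
Proof.
move=> /andP[x_ge0 x4]; have pi2 := pi_ge2 R.
have y_ge0 : 0 <= pi * x by rewrite mulr_ge0//; lra.
have y4 : pi * x <= pi / 4 by rewrite ler_wpM2l//; lra.
have /andP[lo _] : cos (pi * x) * (pi * x) <= sin (pi * x) <= pi * x.
  by apply: sin_bounds; apply/andP; split=> //; lra.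
have cy : 0 <= cos (pi * x) by apply: cos_ge0_pihalf; apply/andP; split; lra.
rewrite (_ : 2 * pi * x = (pi * x) *+ 2); last by rewrite -mulr_natr; ring.
have cos2y : 0 <= cos ((pi * x) *+ 2).
  by apply: cos_ge0_pihalf; rewrite -mulr_natr; apply/andP; split; lra.
rewrite cos_mulr2n -mulr_natr in cos2y.
have xy : x <= pi * x by rewrite ler_peMl//; lra.
rewrite sin_mulr2n -mulr_natr (le_trans xy)//.
have : cos (pi * x) * (cos (pi * x) * (pi * x)) <= cos (pi * x) * sin (pi * x).
  exact: ler_wpM2l.
nra.
Qed.

(** Here [d] is the distance to the nearest zero of the sine, and [c] tells whether that zero is an
    integer or a half-integer; the slope has opposite signs at the two kinds, hence [e (+) c]. *)
Lemma sin_gt0_near_zero (R : realType) (e : bool) (x : R) :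
  0 < (-1) ^+ e * sin (2 * pi * x) ->
  exists (c : bool) (n : int) (d : R),
    [/\ 0 < d, d <= (-1) ^+ e * sin (2 * pi * x)
      & x = c%:R / 2 + n%:~R + (-1) ^+ (e (+) c) * d].
Proof.
wlog -> : e x / e = false => [wlog_e|].
  case: e; last exact: wlog_e.
  rewrite expr1 mulN1r -sinN -mulrN -[sin _]mul1r => s_gt0.
  have [c [n [d [d_gt0 d_le Ex]]]] := wlog_e false (- x) erefl s_gt0.
  (* Reflection sends [c / 2 + n] to [- c / 2 - n = c / 2 + (- n - c)]. *)
  exists c, (- n - c%:R), d; split=> //.
  rewrite -[LHS]opprK {}Ex rmorphB rmorphN.
  by case: c => /=; rewrite ?expr0 ?expr1; field.
rewrite expr0 mul1r.
have [y_ge y_lt [n En]] := (signed_fracP x _).1 erefl.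
set y := signed_frac x in y_ge y_lt En.
have Ex : x = y + n%:~R by rewrite -En addrC subrK.
have -> : sin (2 * pi * x) = sin (2 * pi * y).
  by have := sin_half_turn false n y; rewrite expr0 mul1r mul0r add0r addrC -Ex.
move=> s_gt0; have pi2 := pi_ge2 R.
have y_gt0 : 0 < y.
  rewrite ltNge; apply: contraTN s_gt0 => y_le0; rewrite -leNgt.
  rewrite -oppr_ge0 -sinN -mulrN; apply: sin_ge0_pi.
  apply/andP; split; first by rewrite !mulr_ge0//; lra.
  by rewrite [leLHS](_ : _ = pi * (2 * - y)); [rewrite ler_piMr; lra | ring].
have [y4|y4] := leP y 4^-1.
  exists false, n, y; rewrite y_gt0; split=> //.
    by apply: le_sin_2pi; rewrite ltW.
  by rewrite Ex /= expr0; lra.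
exists true, n, (2^-1 - y); split; first lra.
  rewrite -[leRHS](_ : sin (2 * pi * (2^-1 - y)) = _).
    by apply: le_sin_2pi; apply/andP; split; lra.
  rewrite (_ : _ * (_ - y) = - (2 * pi * y) + pi); last by field.
  by rewrite sinDpi sinN opprK.
by rewrite Ex /= expr1; lra.
Qed.

(** * Odd multiples hitting prescribed intervals *)

Lemma odd_between (R : realType) (x y : R) :
  0 <= x -> x + 2 < y -> exists m, odd m /\ x < m%:R < y.
Proof.
move=> x_ge0 xy; have h : 0 <= (x + 1) / 2 by rewrite divr_ge0//; lra.
have /andP[lo] := truncn_itv h.
set n := Num.truncn _ in lo * => hi.
exists n.*2.+1; split; first by rewrite /= odd_double.
rewrite -[n.+1%:R]natr1 in hi; rewrite -[n.*2.+1%:R]natr1 -muln2 natrM.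
by apply/andP; split; lra.
Qed.

(* Works because ((m + 2) / m) ^ p tends to 1. *)
Lemma odd_powR_between (R : realType) (p a b : R) :
  0 < p -> 0 < a -> a < b ->
  exists2 e0 : R, 0 < e0 & forall e : R, 0 < e < e0 ->
    exists m, odd m /\ a < m%:R `^ p * e < b.
Proof.
move=> p_gt0 a_gt0 ab; have b_gt0 := lt_trans a_gt0 ab.
have pV_gt0 : 0 < p^-1 by rewrite invr_gt0.
have pw0 (x : R) : 0 < x -> x `^ p^-1 `^ p = x.
  by move=> x_gt0; rewrite -powRrM mulVf ?gt_eqF// powRr1// ltW.
pose g := b `^ p^-1 - a `^ p^-1.
have g_gt0 : 0 < g.
  by rewrite subr_gt0 gt0_ltr_powR// nnegrE ltW.
(* After taking [p]-th roots, dividing the interval of length [g] by [e ^ p^-1 < g / 2] makes it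
   longer than 2, so it contains an odd integer. *)
exists ((g / 2) `^ p); first by rewrite powR_gt0// divr_gt0.
move=> e /andP[e_gt0 e_lt].
have r_gt0 : 0 < e `^ p^-1 by rewrite powR_gt0.
have r_lt : e `^ p^-1 < g / 2.
  rewrite ltNge; apply: contraTN e_lt => gr; rewrite -leNgt.
  by rewrite -(pw0 e)// ge0_ler_powR ?nnegrE// ltW// divr_gt0.
have [||m [m_odd /andP[am mb]]] :=
  @odd_between R (a `^ p^-1 / e `^ p^-1) (b `^ p^-1 / e `^ p^-1).
- by rewrite divr_ge0 ?powR_ge0.
- rewrite -ltrBrDl -mulrBl ltr_pdivlMr//; rewrite -/g; lra.
exists m; split=> //.
rewrite ltr_pdivrMr// in am; rewrite ltr_pdivlMr// in mb.
have Em : m%:R `^ p * e = (m%:R * e `^ p^-1) `^ p.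
  by rewrite powRM// ?pw0// ltW.
rewrite Em -{1}(pw0 a)// -{1}(pw0 b)//.
have n_ge0 : 0 <= m%:R * e `^ p^-1 by rewrite mulr_ge0 ?powR_ge0.
by apply/andP; split; apply: gt0_ltr_powR; rewrite ?nnegrE ?powR_ge0.
Qed.

Lemma approx_between (R : realType) (alpha beta : R) (e c : bool) (a b : R) :
  0 < beta -> approx alpha beta e c -> 0 < a -> a < b ->
  exists k, (0 < k)%N /\
    a < (-1) ^+ (e (+) c) * (k%:R `^ beta * sin (2 * pi * k%:R * alpha)) < b.
Proof.
move=> beta_gt0 small a_gt0 ab; have pi_gt0 := pi_gt0 R.
(* The gap between [a] and [a'] absorbs the loss in [sin x >= cos x * x]: once [M * x > a'] and
   [cos x > a / a'], [M * sin x > a]. *)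
pose a' := (a + b) / 2.
have [a'_gt0 aa' a'b] : [/\ 0 < a', a < a' & a' < b] by rewrite /a'; split; lra.
have [r /= r_gt0 cos_gt] : \forall x \near (0 : R), a / a' < cos x.
  apply: (cvgr_gt _ (@continuous_cos R 0)).
  by rewrite cos0 ltr_pdivrMr// mul1r.
have beta1_gt0 : 0 < beta + 1 by lra.
have [e0 e0_gt0 odd_m] := odd_powR_between beta1_gt0 a'_gt0 a'b.
pose eta := Num.min r pi.
have eta_gt0 : 0 < eta by rewrite lt_min r_gt0.
(* This makes [k%:R ^ beta >= b / eta], so that [M * x < b] will force [x < eta]. *)
pose N := (Num.truncn ((b / eta) `^ beta^-1)).+1.
have eps_gt0 : 0 < e0 / (2 * pi) by rewrite divr_gt0// mulr_gt0.
have [k [n [d [Nk d_gt0 kd_lt Ek]]]] := small (e0 / (2 * pi)) N eps_gt0.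
have k_gt0 : (0 < k)%N by apply: leq_trans Nk.
have kb_gt0 : 0 < k%:R `^ beta :> R by rewrite powR_gt0// ltr0n.
have kb_ge : b / eta <= k%:R `^ beta.
  have b_gt0 : 0 < b / eta by rewrite divr_gt0// (lt_trans a_gt0).
  rewrite -[leLHS]powRr1 ?(ltW b_gt0)//
    -[X in _ `^ X <= _](mulVf (lt0r_neq0 beta_gt0)) powRrM.
  rewrite ge0_ler_powR ?nnegrE ?powR_ge0 ?ler0n ?(ltW beta_gt0)//; apply: ltW.
  apply: (@lt_le_trans _ _ N%:R); last by rewrite ler_nat.
  by rewrite -truncn_le_nat.
have [|m [m_odd]] := odd_m (k%:R `^ beta * (2 * pi * d)).
  rewrite !mulr_gt0//=.
  rewrite [ltLHS](_ : _ = k%:R `^ beta * d * (2 * pi)); last by ring.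
  by rewrite -ltr_pdivlMr ?mulr_gt0.
have m_gt0 : (0 < m)%N by case: (m) m_odd.
pose x := 2 * pi * (m%:R * d).
have x_gt0 : 0 < x by rewrite !mulr_gt0// ltr0n.
have -> : m%:R `^ (beta + 1) * (k%:R `^ beta * (2 * pi * d))
          = (m * k)%:R `^ beta * x.
  rewrite powRD; last by rewrite pnatr_eq0 -lt0n m_gt0 implybT.
  by rewrite powRr1// natrM powRM// /x; ring.
set M := (m * k)%:R `^ beta => /andP[lo hi].
have kM : k%:R `^ beta <= M.
  by rewrite ge0_ler_powR ?(ltW beta_gt0) ?nnegrE ?ler0n// ler_nat leq_pmull.
have M_gt0 : 0 < M := lt_le_trans kb_gt0 kM.
have x_lt : x < eta.
  rewrite -(ltr_pM2l M_gt0) (lt_le_trans hi)//.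
  by rewrite -ler_pdivrMr// (le_trans kb_ge).
move: x_lt; rewrite lt_min => /andP[x_ltr x_ltpi].
exists (m * k)%N; split; first by rewrite muln_gt0 m_gt0.
have -> : sin (2 * pi * (m * k)%:R * alpha) = (-1) ^+ (e (+) c) * sin x.
  rewrite -(mulrA (2 * pi)) natrM -(mulrA m%:R) Ek.
  (* For odd [m], [m * c / 2] differs from [c / 2] by the integer [m./2 * c]. *)
  have Em : m%:R = 2 * m./2%:R + 1 :> R.
    by rewrite -{1}(odd_double_half m) m_odd add1n -natr1 -mul2n natrM.
  rewrite [X in 2 * pi * X](_ : _ = c%:R / 2
    + (m./2%:Z * c%:Z + m%:Z * n)%:~R + (-1) ^+ e * (m%:R * d)); last first.
    by rewrite rmorphD !rmorphM /= -!pmulrn Em; field.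
  rewrite sin_half_turn /x addbC signr_addb -(mulrA ((-1) ^+ c)); congr (_ * _).
  by case: (e) => /=; rewrite ?expr1 ?expr0 ?mul1r// !mulN1r mulrN sinN.
rewrite -/M [X in _ < X < _](_ : _ = M * sin x); last first.
  by rewrite mulrCA signrMK.
have /andP[slo shi] : cos x * x <= sin x <= x.
  by apply: sin_bounds; rewrite !ltW.
have cosx : a / a' < cos x.
  by apply: cos_gt; rewrite /ball_ /= sub0r normrN gtr0_norm.
apply/andP; split; last by apply: le_lt_trans hi; rewrite ler_pM2l.
apply: (@lt_le_trans _ _ (M * (cos x * x))); last by rewrite ler_pM2l.
rewrite mulrCA -[ltLHS](@divfK _ a') ?gt_eqF//.
by apply: ltr_pM => //; [exact: divr_ge0 (ltW a_gt0) (ltW a'_gt0) | exact: ltW].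
Qed.

(** * Density, small values and the equivalence *)

Lemma dense_signP (R : realType) (S : set R) :
  dense S <-> forall (e : bool) (a b : R), 0 < a -> a < b ->
    exists2 y, S y & a < (-1) ^+ e * y < b.
Proof.
split=> [dS e a b a_gt0 ab|dS O [x Ox] openO].
  case: e.
    have [||y [/=]] := dS `](- b), (- a)[%classic; last 1 first.
    - rewrite in_itv /= => /andP[yb ya] Sy.
      by exists y => //; rewrite expr1 mulN1r; apply/andP; split; lra.
    - by exists (- ((a + b) / 2)); rewrite /= in_itv /=; apply/andP; split; lra.
    - exact: interval_open.
  have [||y [/=]] := dS `]a, b[%classic; last 1 first.
  - rewrite in_itv /= => /andP[yb ya] Sy.
    by exists y => //; rewrite expr0 mul1r; apply/andP; split; lra.
  - by exists ((a + b) / 2); rewrite /= in_itv /=; apply/andP; split; lra.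
  - exact: interval_open.
have /nbhs_ballP[r /= r_gt0 rO] : nbhs x O by exact: open_nbhs_nbhs.
(* The interval is taken on the side of [x] away from 0, so it avoids 0 even when [x = 0]. *)
have [x_ge0|x_lt0] := leP 0 x.
  have [||y Sy] := dS false (x + r / 3) (x + r / 2); [lra | lra |].
  rewrite expr0 mul1r => /andP[ylo yhi]; exists y; split=> //.
  by apply: rO; rewrite /ball /= ltr_distlC; apply/andP; split; lra.
have [||y Sy] := dS true (- x + r / 3) (- x + r / 2); [lra | lra |].
rewrite expr1 mulN1r => /andP[ylo yhi]; exists y; split=> //.
by apply: rO; rewrite /ball /= ltr_distlC; apply/andP; split; lra.
Qed.

(** The finitely many positive values at indices below [N] have a positive lower bound [r], so a
    positive value below [r] must come from a later index. *)
Lemma small_values_cofinal (R : realType) (g : nat -> R) :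
  (forall a b : R, 0 < a -> a < b -> exists k, a < g k < b) ->
  forall (eps : R) (N : nat), 0 < eps -> exists2 k, (N <= k)%N & 0 < g k < eps.
Proof.
move=> hits eps N eps_gt0.
have [r r_gt0 rP] : exists2 r : R, 0 < r &
    forall k, (k < N)%N -> 0 < g k -> r <= g k.
  elim: N => [|N [r r_gt0 rP]]; first by exists 1.
  have [gN|gN] := ltP 0 (g N).
    exists (Num.min r (g N)) => [|k]; first by rewrite lt_min r_gt0.
    rewrite ltnS leq_eqVlt => /predU1P[-> _|kN gk].
      by rewrite ge_min lexx orbT.
    by rewrite ge_min rP.
  exists r => // k; rewrite ltnS leq_eqVlt => /predU1P[-> |]; last exact: rP.
  by rewrite ltNge gN.
have m_gt0 : 0 < Num.min eps r by rewrite lt_min eps_gt0.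
have [||k /andP[glo ghi]] := hits (Num.min eps r / 2) (Num.min eps r); try lra.
have gk_gt0 : 0 < g k by lra.
move: ghi; rewrite lt_min => /andP[ge gr].
exists k; last by rewrite gk_gt0.
by rewrite leqNgt; apply: contraTN gr => kN; rewrite -leNgt rP.
Qed.

(** Each small value comes from a nearby zero at an integer or a half-integer. If both kinds failed,
    a value beyond both index bounds and below both thresholds would contradict one of them. *)
Lemma approx_of_small_values (R : realType) (alpha beta : R) (e : bool) :
  (forall (eps : R) (N : nat), 0 < eps -> exists2 k, (N <= k)%N &
    0 < (-1) ^+ e * (k%:R `^ beta * sin (2 * pi * k%:R * alpha)) < eps) ->
  approx alpha beta e false \/ approx alpha beta (~~ e) true.
Proof.
move=> small; apply: contrapT => /not_orP[].
move=> /existsNP[eps1 /existsNP[N1 /not_implyP[eps1_gt0 no1]]].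
move=> /existsNP[eps2 /existsNP[N2 /not_implyP[eps2_gt0 no2]]].
have eps_gt0 : 0 < Num.min eps1 eps2 by rewrite lt_min eps1_gt0.
have [k] := small _ (maxn N1 N2).+1 eps_gt0.
move=> /[dup] /ltnW; rewrite geq_max => /andP[N1k N2k] k_gt.
have kb_gt0 : 0 < k%:R `^ beta :> R.
  by rewrite powR_gt0// ltr0n (leq_ltn_trans _ k_gt).
rewrite mulrCA -(mulrA (2 * pi)) pmulr_rgt0// => /andP[s_gt0].
have [c [n [d [d_gt0 d_le Ek]]]] := sin_gt0_near_zero s_gt0.
rewrite lt_min => /andP[lt1 lt2].
have kd : k%:R `^ beta * d <= k%:R `^ beta *
    ((-1) ^+ e * sin (2 * pi * (k%:R * alpha))) by rewrite ler_pM2l.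
case: c Ek => Ek.
  apply: no2; exists k, n, d; split=> //; first exact: le_lt_trans lt2.
  by rewrite Ek addbT.
apply: no1; exists k, n, d; split=> //; first exact: le_lt_trans lt1.
by rewrite Ek addbF.
Qed.

Theorem corollary1 (R : realType) (beta alpha : R)
    (beta_gt0 : 0 < beta) (alpha_irr : irrational alpha) :
  dense [set k%:R `^ beta * sin (2 * pi * k%:R * alpha)
        | k in [set k : nat | (0 < k)%N]]
  <->
  [\/ mu_plus alpha beta 0 = 0%E /\ mu_minus alpha beta 0 = 0%E,
      mu_plus alpha beta 0 = 0%E /\ mu_plus alpha beta 2^-1 = 0%E
    | mu_minus alpha beta 0 = 0%E /\ mu_minus alpha beta 2^-1 = 0%E].
Proof.
have plusP := mu_plus_eq0 alpha _ beta_gt0.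
have minusP := mu_minus_eq0 alpha _ beta_gt0.
have := (plusP false, plusP true, minusP false, minusP true).
rewrite mul0r mul1r => -[[[p0 p1] m0] m1]; rewrite dense_signP.
split=> [dS|cases e a b a_gt0 ab].
  have near e : approx alpha beta e false \/ approx alpha beta (~~ e) true.
    apply: approx_of_small_values; apply: small_values_cofinal => a b a_gt0 ab.
    by have [_ [k _ <-] ?] := dS e a b a_gt0 ab; exists k.
  (* Three combinations are the listed cases; in the fourth, both conditions at one half pass to 0
     by doubling. *)
  have [Ap|Am1] := near false; have [Am|Ap1] := near true.
  - by apply: Or31; split; [apply/p0 | apply/m0].
  - by apply: Or32; split; [apply/p0 | apply/p1].
  - by apply: Or33; split; [apply/m0 | apply/m1].
  - by apply: Or31; split; [apply/p0 | apply/m0]; exact: approx_double.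
have hit c e' : e' (+) c = e -> approx alpha beta e' c ->
    exists2 y, [set k%:R `^ beta * sin (2 * pi * k%:R * alpha)
      | k in [set k : nat | (0 < k)%N]] y & a < (-1) ^+ e * y < b.
  move=> <- /approx_between -/(_ a b beta_gt0 a_gt0 ab) [k [k_gt0 kab]].
  by eexists; [exists k | exact: kab].
(* Positive values come from [mu_plus] at 0 or [mu_minus] at one half, negative ones from [mu_minus]
   at 0 or [mu_plus] at one half; each case supplies both signs. *)
case: cases => -[h1 h2]; case: e hit => hit.
- by apply: (hit false true) => //; apply/m0.
- by apply: (hit false false) => //; apply/p0.
- by apply: (hit true false) => //; apply/p1.
- by apply: (hit false false) => //; apply/p0.
- by apply: (hit false true) => //; apply/m0.
- by apply: (hit true true) => //; apply/m1.
Qed.
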